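(* Let $d,n\ge1$, let $A_0,A_1,\dots,A_n\in\mathbb{C}^{d\times d}_{\mathrm{herm}}$, and put $\Phi(S)=\sum_{i=1}^nA_iSA_i$. Consider the primal problem (P) the infimum of $c$ over $c\in\mathbb{R}$, $Z\in\mathbb{C}^{d\times d}_{\mathrm{herm}}$ subject to $\begin{bmatrix} cI_d-A_0-\Phi(Z) & I_d\\ I_d & Z\end{bmatrix}\succeq0$, and the dual problem (D) the maximum of $\langle A_0,S\rangle+2\,\mathrm{Re}(\mathrm{Tr}(T))$ over $S\in\mathbb{C}^{d\times d}_{\mathrm{herm}}$, $T\in\mathbb{C}^{d\times d}$ subject to $\begin{bmatrix}S&-T\\-T^*&\Phi(S)\end{bmatrix}\succeq0$ and $\mathrm{Tr}(S)=1$. Suppose that the infimum in (P) is achieved by some $(c,Z)$ and that $(S,T)$ achieves the maximum in (D). Then $$Z\succ0,$$ $$S=Z\,\Phi(S)\,Z,$$ $$T=Z\,\Phi(S)=SZ^{-1},$$ $$(cI_d-A_0-\Phi(Z)-Z^{-1})\,S=0.$$ If $S\succ0$, then further $$cI_d-A_0-\Phi(Z)-Z^{-1}=0,$$ $$Z=\Phi(S)^{-1/2}\big(\Phi(S)^{1/2}S\,\Phi(S)^{1/2}\big)^{1/2}\Phi(S)^{-1/2}$$ (where in particular $\Phi(S)\succ0$, so that the right-hand side is defined).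
   Context: $\mathbb{C}^{d\times d}_{\mathrm{herm}}$ is the set of $d\times d$ complex Hermitian matrices; $\succeq$, $\succ$ denote the Loewner order; $\langle X,Y\rangle=\mathrm{Tr}(X^*Y)$; square roots are positive semidefinite square roots. *)

(* Defs.v *)
From HB Require Import structures.
From mathcomp Require Import all_boot all_order all_algebra.
From mathcomp Require Import all_classical all_reals all_analysis.
From mathcomp Require Export complex.

Set Implicit Arguments.
Unset Strict Implicit.
Unset Printing Implicit Defensive.

Import Order.TTheory GRing.Theory Num.Theory.

Local Open Scope classical_set_scope.
Local Open Scope ring_scope.
Local Open Scope complex_scope.
Local Open Scope sesquilinear_scope.

Section Semidefinite.
Context {R : realType}.

(* In the order of R[i], [0 <= z] (resp. [0 < z]) means that z is real and
   nonnegative (resp. positive). *)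
Definition psdmx m (M : 'M[R[i]]_m) : Prop :=
  M \is hermsymmx /\ forall x : 'cV[R[i]]_m, 0 <= (x^t* *m M *m x) 0 0.

Definition pdmx m (M : 'M[R[i]]_m) : Prop :=
  M \is hermsymmx /\
  forall x : 'cV[R[i]]_m, x != 0 -> 0 < (x^t* *m M *m x) 0 0.

(* The unique positive semidefinite B with B B = M when M is positive
   semidefinite; 0 when M has no such square root. *)
Definition sqrtmx m (M : 'M[R[i]]_m) : 'M[R[i]]_m :=
  xget 0 [set B | psdmx B /\ B *m B = M].

Definition mxinner m (X Y : 'M[R[i]]_m) : R[i] := \tr (X^t* *m Y).

End Semidefinite.

Section PrimalDual.
Context {R : realType} {d n : nat}.
Variables (A0 : 'M[R[i]]_d) (A : 'I_n -> 'M[R[i]]_d).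

Definition Phi (S : 'M[R[i]]_d) : 'M[R[i]]_d := \sum_(i < n) A i *m S *m A i.

Definition primal_feasible (c : R) (Z : 'M[R[i]]_d) : Prop :=
  Z \is hermsymmx /\
  psdmx (block_mx ((c%:C)%:M - A0 - Phi Z) 1%:M 1%:M Z).

Definition primal_value : \bar R :=
  ereal_inf [set c%:E | c in [set c | exists Z, primal_feasible c Z]].

Definition primal_optimal (c : R) (Z : 'M[R[i]]_d) : Prop :=
  primal_feasible c Z /\ c%:E = primal_value.

Definition dual_feasible (S T : 'M[R[i]]_d) : Prop :=
  [/\ S \is hermsymmx,
      psdmx (block_mx S (- T) (- T^t*) (Phi S)) &
      \tr S = 1].

(* When A0 and S are Hermitian this complex number is real, so the order of
   R[i] compares such values as real numbers. *)
Definition dual_objective (S T : 'M[R[i]]_d) : R[i] :=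
  mxinner A0 S + 2 * 'Re (\tr T).

Definition dual_optimal (S T : 'M[R[i]]_d) : Prop :=
  dual_feasible S T /\
  forall S' T', dual_feasible S' T' ->
    dual_objective S' T' <= dual_objective S T.

End PrimalDual.

(* Main.v *)
Require Import Defs.
From HB Require Import structures.
From mathcomp Require Import all_boot all_order all_algebra.
From mathcomp Require Import all_classical all_reals all_analysis.
From mathcomp Require Import complex.
From mathcomp Require Import ring lra.

(**
The statement is complementary slackness for a semidefinite program and its
dual, once it is known that the two optimal values coincide.

Complementary slackness.  Write X for the block matrix constrained in (P) and
W for the one constrained in (D).  For feasible points, tr (X W) is the
difference between the primal and the dual objective ([duality_gap]).  If that
gap is zero, then X W = 0, because X and W are positive semidefinite
([psd_trace_mul_eq0]); the four blocks of X W = 0 give the claimed identities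
once Z is known to be invertible.  Z is positive definite because a vector x
with x^* Z x = 0 gives (0, x) in the kernel of X, whose top block is the
identity applied to x ([pd_of_psd_block_1]).  When S is positive definite one
can cancel it, and S = Z P Z with P = Phi(S) gives
(P^(1/2) Z P^(1/2))^2 = P^(1/2) S P^(1/2), so the formula for Z is the
uniqueness of positive semidefinite square roots ([psd_sqrt_inj]).

Zero gap.  Let c be the optimal value of (P), G the constant term of the
constraint of (P) at level c, and L(H) = diag (- Phi(H), H), so that
X = G + L(Z).  Densities (positive semidefinite matrices of trace 1) form a
compact convex set.  The linear map sending W to
(W_22 - Phi(W_11), tr (G W)) therefore attains its minimal norm on
densities, say with value (H, r), and the minimiser satisfies a variational
inequality ([density_variational]).
If (H, r) = 0, the minimiser is, after rescaling, a dual feasible point with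
objective c.  Otherwise the variational inequality says that
L(H) + r G - e is positive semidefinite for some e > 0
([dual_alternative]).  For r > 0, dividing by r makes c - e / r feasible in (P)
([primal_feasible_of_slack]), against the optimality of c.  For r <= 0, adding
- r X shows that L(H - r Z) - e is positive semidefinite, which is impossible:
H - r Z would be positive and Phi would map it to a negative matrix
([no_recession]).  Hence (D) reaches the value c ([strong_duality]).
*)

Set Implicit Arguments.
Unset Strict Implicit.
Unset Printing Implicit Defensive.

Import Order.TTheory GRing.Theory Num.Theory.
Import numFieldNormedType.Exports.

Local Open Scope ring_scope.
Local Open Scope complex_scope.

(** * Adjoints and Gram matrices *)

Section Adjoint.
Local Open Scope sesquilinear_scope.
Context {C : numClosedFieldType}.

Lemma adjmxM m n p (A : 'M[C]_(m, n)) (B : 'M[C]_(n, p)) :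
  (A *m B)^t* = B^t* *m A^t*.
Proof. by rewrite trmx_mul map_mxM. Qed.

Lemma adjmxD m n (A B : 'M[C]_(m, n)) : (A + B)^t* = A^t* + B^t*.
Proof. by rewrite linearD map_mxD. Qed.

Lemma adjmxN m n (A : 'M[C]_(m, n)) : (- A)^t* = - A^t*.
Proof. by rewrite linearN map_mxN. Qed.

Lemma adjmxZ m n (a : C) (A : 'M[C]_(m, n)) : (a *: A)^t* = Num.conj a *: A^t*.
Proof. by rewrite linearZ map_mxZ. Qed.

Lemma adjmx_scalar n (a : C) : (a%:M : 'M[C]_n)^t* = (Num.conj a)%:M.
Proof. by rewrite tr_scalar_mx map_scalar_mx. Qed.

Lemma adjmx_block m1 m2 n1 n2 (A : 'M[C]_(m1, n1)) (B : 'M[C]_(m1, n2))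
    (D : 'M[C]_(m2, n1)) (E : 'M[C]_(m2, n2)) :
  (block_mx A B D E)^t* = block_mx (A^t*) (D^t*) (B^t*) (E^t*).
Proof. by rewrite tr_block_mx map_block_mx. Qed.

Lemma mxtrace_adj n (A : 'M[C]_n) : \tr (A^t*) = Num.conj (\tr A).
Proof.
by rewrite /mxtrace rmorph_sum /=; apply: eq_bigr => i _; rewrite !mxE.
Qed.

Lemma hermmxP n (A : 'M[C]_n) : reflect (A^t* = A) (A \is hermsymmx).
Proof. by rewrite qualifE /= expr0 scale1r eq_sym; exact: eqP. Qed.

Lemma mxtrace_gram m n (X : 'M[C]_(m, n)) :
  \tr (X^t* *m X) = \sum_j \sum_i `|X i j| ^+ 2.
Proof.
apply: eq_bigr => j _; rewrite !mxE; apply: eq_bigr => i _.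
by rewrite !mxE mulrC normCK.
Qed.

Lemma mxtrace_gram_ge0 m n (X : 'M[C]_(m, n)) : 0 <= \tr (X^t* *m X).
Proof.
rewrite mxtrace_gram; apply: sumr_ge0 => j _; apply: sumr_ge0 => i _.
exact: exprn_ge0.
Qed.

Lemma mxtrace_gram_eq0 m n (X : 'M[C]_(m, n)) : \tr (X^t* *m X) = 0 -> X = 0.
Proof.
move/eqP; rewrite mxtrace_gram psumr_eq0; last first.
  by move=> j _; apply: sumr_ge0 => i _; exact: exprn_ge0.
move/allP => X0; apply/matrixP => i j; rewrite mxE.
have /= := X0 j (mem_index_enum _); rewrite psumr_eq0; last first.
  by move=> k _; exact: exprn_ge0.
by move/allP/(_ i (mem_index_enum _)); rewrite /= expf_eq0 normr_eq0 => /eqP.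
Qed.

Lemma entry_le_mxtrace_gram m n (X : 'M[C]_(m, n)) i j :
  `|X i j| ^+ 2 <= \tr (X^t* *m X).
Proof.
rewrite mxtrace_gram (bigD1 j) //= (bigD1 i) //= -addrA lerDl.
by rewrite addr_ge0 ?sumr_ge0 // => *; rewrite ?sumr_ge0 // => *;
  exact: exprn_ge0.
Qed.

Lemma mx11E (A : 'M[C]_1) : A 0 0 = \tr A.
Proof. by rewrite /mxtrace big_ord1. Qed.

End Adjoint.

(** * Positive semidefinite matrices *)

Section Semidefinite.
Local Open Scope sesquilinear_scope.
Context {R : realType}.
Local Notation C := R[i].
Implicit Types m n : nat.

Lemma gram_psd m n (Y : 'M[C]_(n, m)) : psdmx (Y^t* *m Y).
Proof.
split; first by apply/hermmxP; rewrite adjmxM trmxCK.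
move=> x; rewrite mulmxA -mulmxA -adjmxM mx11E; exact: mxtrace_gram_ge0.
Qed.

(** Take square roots of the eigenvalues in a unitary diagonalisation.  That
the result is again positive semidefinite is seen by taking square roots of
the eigenvalues twice, which exhibits it as a Gram matrix. *)
Lemma psd_sqrt_exists m (M : 'M[C]_m) :
  psdmx M -> exists B, psdmx B /\ B *m B = M.
Proof.
move=> [Mh Mge0].
have /hermitian_normalmx/orthomx_spectralP := Mh.
have Pu := spectral_unitarymx M; set P := spectralmx M in Pu *.
set d := spectral_diag M; rewrite (invmx_unitary Pu) => ME.
have PPt : P *m P^t* = 1%:M by apply/unitarymxP.
have d_ge0 j : 0 <= d 0 j.
  have := Mge0 (P^t* *m delta_mx j 0).
  rewrite ME adjmxM trmxCK -!mulmxA (mulmxA P (P^t*)) PPt mul1mx.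
  rewrite (mulmxA P (P^t*)) PPt mul1mx.
  rewrite mxE (bigD1 j) //= big1; last first.
    by move=> k /negPf kj; rewrite !mxE kj /= conjC0 mul0r.
  by rewrite addr0 mul_diag_mx !mxE !eqxx /= conjC1 mul1r mulr1.
pose s : 'rV[C]_m := \row_j sqrtC (d 0 j).
pose q : 'rV[C]_m := \row_j sqrtC (s 0 j).
have s_ge0 j : 0 <= s 0 j by rewrite mxE sqrtC_ge0.
have BE : (diag_mx q *m P)^t* *m (diag_mx q *m P) = P^t* *m diag_mx s *m P.
  rewrite adjmxM -!mulmxA; congr (_ *m _); rewrite mulmxA; congr (_ *m _).
  have q_real : map_mx Num.conj q = q.
    apply/rowP => j; rewrite !mxE; apply/CrealP.
    by rewrite ger0_real// !sqrtC_ge0.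
  rewrite tr_diag_mx map_diag_mx q_real mulmx_diag; congr diag_mx.
  by apply/rowP => j; rewrite !mxE -expr2 sqrtCK.
exists (P^t* *m diag_mx s *m P); split; first by rewrite -BE; exact: gram_psd.
rewrite ME -!mulmxA; congr (_ *m _); rewrite (mulmxA P (P^t*)) PPt mul1mx.
rewrite mulmxA; congr (_ *m _); rewrite mulmx_diag; congr diag_mx.
by apply/rowP => j; rewrite !mxE -expr2 sqrtCK.
Qed.

Lemma psd_herm m (M : 'M[C]_m) : psdmx M -> M^t* = M.
Proof. by case=> /hermmxP. Qed.

(** Together with [gram_psd], this turns the statements on positive
semidefinite matrices below into computations with Frobenius norms. *)
Lemma psd_gram m (M : 'M[C]_m) : psdmx M -> exists Y : 'M[C]_m, M = Y^t* *m Y.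
Proof.
by case/psd_sqrt_exists => B [/psd_herm Bh BB]; exists B; rewrite Bh.
Qed.

Lemma psdD m (M N : 'M[C]_m) : psdmx M -> psdmx N -> psdmx (M + N).
Proof.
move=> [Mh Mp] [Nh Np]; split.
  by apply/hermmxP; rewrite adjmxD (hermmxP _ Mh) (hermmxP _ Nh).
by move=> x; rewrite mulmxDr mulmxDl mxE addr_ge0.
Qed.

Lemma psdZ m (a : C) (M : 'M[C]_m) : 0 <= a -> psdmx M -> psdmx (a *: M).
Proof.
move=> a0 [Mh Mp]; split.
  apply/hermmxP; rewrite adjmxZ (hermmxP _ Mh).
  by have /CrealP -> : a \is Num.real by rewrite ger0_real.
by move=> x; rewrite -scalemxAr -scalemxAl mxE mulr_ge0.
Qed.

Lemma psd_congr m n (X : 'M[C]_(m, n)) (M : 'M[C]_m) :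
  psdmx M -> psdmx (X^t* *m M *m X).
Proof.
move=> /psd_gram[Y ->].
by rewrite mulmxA -mulmxA -adjmxM; exact: gram_psd.
Qed.

Lemma psd_sum m n (F : 'I_n -> 'M[C]_m) :
  (forall i, psdmx (F i)) -> psdmx (\sum_i F i).
Proof.
move=> Fp; apply: (big_ind (@psdmx R m)) => [|M N|i _].
- by have := gram_psd (0 : 'M[C]_m); rewrite mulmx0.
- exact: psdD.
- exact: Fp.
Qed.

Lemma psd_scalar m (a : C) : 0 <= a -> psdmx (a%:M : 'M[C]_m).
Proof.
move=> a0; rewrite -scalemx1; apply: psdZ => //.
by have := gram_psd (1%:M : 'M[C]_m); rewrite mulmx1 adjmx_scalar rmorph1.
Qed.

Lemma psd_trace_ge0 m (M : 'M[C]_m) : psdmx M -> 0 <= \tr M.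
Proof. by move=> /psd_gram[Y ->]; exact: mxtrace_gram_ge0. Qed.

Lemma psd_trace_eq0 m (M : 'M[C]_m) : psdmx M -> \tr M = 0 -> M = 0.
Proof.
by move=> /psd_gram[Y ->] /mxtrace_gram_eq0 ->; rewrite mulmx0.
Qed.

(** With M = Y^* Y, the value x^* M x is the squared norm of Y x. *)
Lemma psd_kernel m (M : 'M[C]_m) (x : 'cV[C]_m) :
  psdmx M -> (x^t* *m M *m x) 0 0 = 0 -> M *m x = 0.
Proof.
move=> /psd_gram[Y ->].
rewrite mulmxA -mulmxA -adjmxM mx11E => /mxtrace_gram_eq0 Yx0.
by rewrite -mulmxA Yx0 mulmx0.
Qed.


(** The trace of a product of two Gram matrices is a squared Frobenius norm;
this gives both the sign of the trace and its equality case. *)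
Lemma trace_gram_mul m n p (X : 'M[C]_(m, n)) (Y : 'M[C]_(p, n)) :
  \tr (Y^t* *m Y *m (X^t* *m X)) = \tr ((Y *m X^t*)^t* *m (Y *m X^t*)).
Proof. by rewrite mulmxA mxtrace_mulC adjmxM trmxCK !mulmxA. Qed.

Lemma psd_trace_mul_ge0 m (M N : 'M[C]_m) :
  psdmx M -> psdmx N -> 0 <= \tr (M *m N).
Proof.
move=> /psd_gram[Y ->] /psd_gram[X ->].
by rewrite trace_gram_mul; exact: mxtrace_gram_ge0.
Qed.

Lemma psd_trace_mul_eq0 m (M N : 'M[C]_m) :
  psdmx M -> psdmx N -> \tr (M *m N) = 0 -> M *m N = 0.
Proof.
move=> /psd_gram[Y ->] /psd_gram[X ->].
rewrite trace_gram_mul => /mxtrace_gram_eq0 YX0.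
by rewrite mulmxA -(mulmxA _ Y) YX0 mulmx0 mul0mx.
Qed.

(** With E = B - D one has (B + D) E + E (B + D) = 2 (B^2 - D^2) = 0.
Multiplying by E and taking traces, the positive semidefinite matrices E B E
and E D E have opposite traces, so both vanish; their difference is E^3, and a
Hermitian nilpotent matrix is zero. *)
Lemma psd_sqrt_inj m (B D : 'M[C]_m) :
  psdmx B -> psdmx D -> B *m B = D *m D -> B = D.
Proof.
move=> Bp Dp BD; have [E EE] : {E | E = B - D} by exists (B - D).
have Eh : E^t* = E by rewrite EE adjmxD adjmxN !psd_herm.
have EBp : psdmx (E *m B *m E) by rewrite -{1}Eh; exact: psd_congr.
have EDp : psdmx (E *m D *m E) by rewrite -{1}Eh; exact: psd_congr.
have sum0 : (B + D) *m E + E *m (B + D) = 0.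
  rewrite EE !(mulmxDl, mulmxDr, mulmxN, mulNmx) BD.
  rewrite addrC [X in _ + X]addrC [D *m D + _]addrC [- _ - _]addrC !addrA.
  by rewrite addrK !addrNK subrr.
have tr0 : \tr (E *m B *m E) + \tr (E *m D *m E) = 0.
  have := congr1 (fun M => \tr (E *m M)) sum0.
  rewrite mulmx0 mulmxDr mxtraceD linear0 (mxtrace_mulC E (E *m _)) mulmxA.
  rewrite mulmxDr mulmxDl mxtraceD => /eqP.
  by rewrite -mulr2n mulrn_eq0 => /eqP.
have /eqP := tr0; rewrite paddr_eq0 ?psd_trace_ge0 // => /andP[/eqP tB /eqP tD].
have E3 : E *m E *m E = 0.
  rewrite {2}EE mulmxBr mulmxBl.
  by rewrite (psd_trace_eq0 EBp tB) (psd_trace_eq0 EDp tD) subrr.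
have E2 : E *m E = 0.
  apply: mxtrace_gram_eq0; rewrite adjmxM Eh mulmxA E3 mul0mx; exact: linear0.
apply/eqP; rewrite -subr_eq0 -EE; apply/eqP.
by apply: mxtrace_gram_eq0; rewrite Eh E2 linear0.
Qed.

Lemma sqrtmxE m (B M : 'M[C]_m) : psdmx B -> B *m B = M -> sqrtmx M = B.
Proof.
move=> Bp BM; apply: xget_unique; first by split.
by move=> D [Dp DM]; apply: psd_sqrt_inj => //; rewrite DM BM.
Qed.

Lemma sqrtmxP m (M : 'M[C]_m) : psdmx M ->
  psdmx (sqrtmx M) /\ sqrtmx M *m sqrtmx M = M.
Proof. by case/psd_sqrt_exists => B [Bp BM]; rewrite (sqrtmxE Bp BM). Qed.

Lemma pd_psd m (M : 'M[C]_m) : pdmx M -> psdmx M.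
Proof.
move=> [Mh Mp]; split=> // x; have [->|/Mp/ltW//] := eqVneq x 0.
by rewrite mulmx0 mxE.
Qed.

Lemma psd_unit_pd m (M : 'M[C]_m) : psdmx M -> M \in unitmx -> pdmx M.
Proof.
move=> Mp Mu; split; first by case: Mp.
move=> x x0; rewrite lt_def (proj2 Mp) andbT; apply: contra x0 => /eqP.
by move=> /(psd_kernel Mp) Mx0; rewrite -(mulKmx Mu x) Mx0 mulmx0.
Qed.

Lemma pd_unit m (M : 'M[C]_m) : pdmx M -> M \in unitmx.
Proof.
move=> [Mh Mp]; rewrite -unitmx_tr -row_free_unit -kermx_eq0.
apply/eqP/row_matrixP => i; rewrite row0.
apply/eqP/negP => /negP ri.
have := Mp (row i (kermx M^T))^T.
rewrite trmx_eq0 => /(_ ri); rewrite -mulmxA -{2}(trmxK M) -trmx_mul.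
by rewrite -row_mul mulmx_ker row0 trmx0 mulmx0 mxE ltxx.
Qed.

End Semidefinite.

(** * Minimal-norm points over densities *)

Section ComplexContinuity.
Local Open Scope sesquilinear_scope.
Context {R : realType} {P : topologicalType}.
Local Notation C := R[i].

(** Continuity is split into real and imaginary parts so that compactness and
extreme values are only used over the real numbers. *)
Definition ccontinuous (f : P -> C) : Prop :=
  continuous (fun p => complex.Re (f p)) /\
  continuous (fun p => complex.Im (f p)).

Lemma ccontinuousD (f g : P -> C) : ccontinuous f -> ccontinuous g ->
  ccontinuous (fun p => f p + g p).
Proof.
move=> [fr fi] [gr gi]; split.
  rewrite (_ : (fun _ => _) = fun p => complex.Re (f p) + complex.Re (g p)).
    by move=> p; exact: cvgD (fr p) (gr p).
  by apply/funext => p; case: (f p) (g p) => [? ?] [? ?].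
rewrite (_ : (fun _ => _) = fun p => complex.Im (f p) + complex.Im (g p)).
  by move=> p; exact: cvgD (fi p) (gi p).
by apply/funext => p; case: (f p) (g p) => [? ?] [? ?].
Qed.

Lemma ccontinuousM (f g : P -> C) : ccontinuous f -> ccontinuous g ->
  ccontinuous (fun p => f p * g p).
Proof.
move=> [fr fi] [gr gi]; split.
  rewrite (_ : (fun _ => _) = fun p => complex.Re (f p) * complex.Re (g p) -
                                      complex.Im (f p) * complex.Im (g p)).
    by move=> p; exact: cvgB (cvgM (fr p) (gr p)) (cvgM (fi p) (gi p)).
  by apply/funext => p; case: (f p) (g p) => [? ?] [? ?].
rewrite (_ : (fun _ => _) = fun p => complex.Re (f p) * complex.Im (g p) +
                                    complex.Im (f p) * complex.Re (g p)).
  by move=> p; exact: cvgD (cvgM (fr p) (gi p)) (cvgM (fi p) (gr p)).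
by apply/funext => p; case: (f p) (g p) => [? ?] [? ?].
Qed.

Lemma ccontinuous_conj (f : P -> C) : ccontinuous f ->
  ccontinuous (fun p => Num.conj (f p)).
Proof.
move=> [fr fi]; split.
  rewrite (_ : (fun _ => _) = fun p => complex.Re (f p)) //.
  by apply/funext => p; case: (f p).
rewrite (_ : (fun _ => _) = fun p => - complex.Im (f p)).
  by move=> p; exact: cvgN (fi p).
by apply/funext => p; case: (f p).
Qed.

Lemma ccontinuous_cst (a : C) : ccontinuous (fun=> a).
Proof. by split=> p; exact: cvg_cst. Qed.

Lemma ccontinuous_sum (I : finType) (f : I -> P -> C) :
  (forall i, ccontinuous (f i)) -> ccontinuous (fun p => \sum_i f i p).
Proof.
move=> fc.
suff H (s : seq I) : ccontinuous (fun p => \sum_(i <- s) f i p) by exact: H.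
elim: s => [|i s IH].
  under eq_fun do rewrite big_nil.
  exact: ccontinuous_cst.
under eq_fun do rewrite big_cons.
exact: ccontinuousD.
Qed.

Definition mxcontinuous m n (F : P -> 'M[C]_(m, n)) : Prop :=
  forall i j, ccontinuous (fun p => F p i j).

Lemma mxcontinuous_adj m n (F : P -> 'M[C]_(m, n)) :
  mxcontinuous F -> mxcontinuous (fun p => (F p)^t*).
Proof.
move=> Fc i j; under eq_fun do rewrite !mxE.
exact: ccontinuous_conj.
Qed.

Lemma mxcontinuous_mul m n k (F : P -> 'M[C]_(m, n)) (G : P -> 'M[C]_(n, k)) :
  mxcontinuous F -> mxcontinuous G -> mxcontinuous (fun p => F p *m G p).
Proof.
move=> Fc Gc i j; under eq_fun do rewrite !mxE.
by apply: ccontinuous_sum => l; exact: ccontinuousM.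
Qed.

Lemma mxcontinuous_linear m n p q (l : {linear 'M[C]_(m, n) -> 'M[C]_(p, q)})
    (F : P -> 'M[C]_(m, n)) :
  mxcontinuous F -> mxcontinuous (fun p => l (F p)).
Proof.
move=> Fc i j.
rewrite (_ : (fun _ => _) =
  fun p => \sum_a \sum_b F p a b * l (delta_mx a b) i j).
  apply: ccontinuous_sum => a; apply: ccontinuous_sum => b.
  by apply: ccontinuousM => //; exact: ccontinuous_cst.
apply/funext => x; rewrite {1}(matrix_sum_delta (F x)) linear_sum summxE.
apply: eq_bigr => a _; rewrite linear_sum summxE; apply: eq_bigr => b _.
by rewrite linearZ mxE.
Qed.

Lemma ccontinuous_trace n (F : P -> 'M[C]_n) :
  mxcontinuous F -> ccontinuous (fun p => \tr (F p)).
Proof. by move=> Fc; apply: ccontinuous_sum => i; exact: Fc. Qed.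

End ComplexContinuity.

Section Variational.
Local Open Scope sesquilinear_scope.
Local Open Scope classical_set_scope.
Context {R : realType}.
Local Notation C := R[i].

(** Real coordinates on complex matrices, under which [rV_compact] applies. *)
Definition mx_of_coords m (p : 'rV[R]_(m * m) * 'rV[R]_(m * m)) : 'M[C]_m :=
  \matrix_(i, j) (p.1 0 (mxvec_index i j) +i* p.2 0 (mxvec_index i j))%C.

Lemma mx_of_coords_onto m (Y : 'M[C]_m) : exists p, mx_of_coords p = Y.
Proof.
exists (\row_k complex.Re (mxvec Y 0 k), \row_k complex.Im (mxvec Y 0 k)).
by apply/matrixP => i j; rewrite !mxE /= mxvecE; case: (Y i j).
Qed.

Lemma mx_of_coords_continuous m : mxcontinuous (@mx_of_coords m).
Proof.
move=> i j; under eq_fun do rewrite mxE.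
split=> /= p.
  apply: (@cvg_comp _ _ _ fst
    (fun v : 'rV[R]_(m * m) => v 0 (mxvec_index i j))).
    exact: cvg_fst.
  exact: coord_continuous.
apply: (@cvg_comp _ _ _ snd
  (fun v : 'rV[R]_(m * m) => v 0 (mxvec_index i j))).
  exact: cvg_snd.
exact: coord_continuous.
Qed.

Lemma compact_unit_sphere m :
  compact [set p |
    complex.Re (\tr ((@mx_of_coords m p)^t* *m mx_of_coords p)) = 1].
Proof.
pose box := [set v : 'rV[R]_(m * m) | forall k, `[-1, 1]%classic (v ord0 k)].
have boxc : compact box.
  apply: (@rV_compact R (m * m) (fun=> `[-1, 1]%classic)) => k.
  exact: segment_compact.
apply: (@subclosed_compact _ _ (box `*` box)); last 2 first.
- exact: compact_setX.
- move=> p /= Y1.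
  have tr1 : \tr ((mx_of_coords p)^t* *m mx_of_coords p) = 1.
    by rewrite -(RRe_real (ger0_real (mxtrace_gram_ge0 _))) Y1.
  have coord_le i j : complex.Re (mx_of_coords p i j) ^+ 2 +
      complex.Im (mx_of_coords p i j) ^+ 2 <= 1.
    by rewrite -lecR add_Re2_Im2 rmorph1 -tr1; exact: entry_le_mxtrace_gram.
  split=> k /=; case/mxvec_indexP: k => i j; rewrite in_itv /=;
    have := coord_le i j; rewrite !mxE /=.
  - set x := p.1 _ _; set y := p.2 _ _; nra.
  - set x := p.1 _ _; set y := p.2 _ _; nra.
have [trc _] : ccontinuous (fun p =>
    \tr ((@mx_of_coords m p)^t* *m mx_of_coords p)).
  apply/ccontinuous_trace/mxcontinuous_mul; last exact: mx_of_coords_continuous.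
  exact/mxcontinuous_adj/mx_of_coords_continuous.
by move/continuous_closedP: trc => trc; exact: (trc _ (@closed_eq _ 1)).
Qed.

(** If a < 0, then t = - a / (b - a) makes t * b smaller than - a. *)
Lemma nonneg_of_small_perturbation (F : realFieldType) (a b : F) : 0 <= b ->
  (forall t, 0 < t -> t <= 1 -> 0 <= a + t * b) -> 0 <= a.
Proof.
move=> b0 H; rewrite leNgt; apply/negP => a0.
have ba : 0 < b - a by lra.
have t0 : 0 < - a / (b - a) by rewrite divr_gt0// oppr_gt0.
have t1 : - a / (b - a) <= 1 by rewrite ler_pdivrMr// mul1r lerDr.
have := H _ t0 t1.
have -> : - a / (b - a) * b = - a - a ^+ 2 / (b - a).
  by field; rewrite gt_eqF.
have : 0 < a ^+ 2 / (b - a) by rewrite divr_gt0// exprn_even_gt0 //= lt_eqF.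
lra.
Qed.

(** Densities are the Gram matrices of the points of the unit sphere of the
Frobenius norm, so minimising over densities is minimising over a sphere. *)
Lemma density_mx_of_coords m (W : 'M[C]_m) : psdmx W -> \tr W = 1 ->
  exists p, complex.Re (\tr ((@mx_of_coords m p)^t* *m mx_of_coords p)) = 1 /\
            W = (mx_of_coords p)^t* *m mx_of_coords p.
Proof.
move=> /psd_gram[Y WE] W1; have [p pY] := mx_of_coords_onto Y.
by exists p; rewrite pY -WE W1.
Qed.

Lemma density_minimum m n (l : {linear 'M[C]_m -> 'M[C]_n}) : (0 < m)%N ->
  exists2 W0, psdmx W0 /\ \tr W0 = 1 & forall W, psdmx W -> \tr W = 1 ->
    complex.Re (mxinner (l W0) (l W0)) <= complex.Re (mxinner (l W) (l W)).
Proof.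
move=> m_gt0.
pose gram p := (@mx_of_coords m p)^t* *m mx_of_coords p.
pose f p := complex.Re (mxinner (l (gram p)) (l (gram p))).
have gram_cont : mxcontinuous gram.
  apply: mxcontinuous_mul; last exact: mx_of_coords_continuous.
  exact/mxcontinuous_adj/mx_of_coords_continuous.
have [f_cont _] : ccontinuous (fun p => mxinner (l (gram p)) (l (gram p))).
  apply/ccontinuous_trace/mxcontinuous_mul; last exact: mxcontinuous_linear.
  exact/mxcontinuous_adj/mxcontinuous_linear.
have E_psd : psdmx ((m%:R^-1)%:M : 'M[C]_m).
  by apply: psd_scalar; rewrite invr_ge0 ler0n.
have E_tr : \tr ((m%:R^-1)%:M : 'M[C]_m) = 1.
  by rewrite mxtrace_scalar -[LHS]mulr_natr mulVf // pnatr_eq0 -lt0n.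
have [q [q1 _]] := density_mx_of_coords E_psd E_tr.
have f_cont_sphere :
    {within [set p | complex.Re (\tr (gram p)) = 1], continuous f}.
  exact: continuous_subspaceT.
have [|p] := compact_EVT_min _ (@compact_unit_sphere m) f_cont_sphere.
  by exists q.
rewrite inE /= => p1 p_min; exists (gram p).
  split; first exact: gram_psd.
  by rewrite -(RRe_real (ger0_real (mxtrace_gram_ge0 _))) p1.
move=> W Wp W1; have [r [r1 ->]] := density_mx_of_coords Wp W1.
by apply: p_min; rewrite inE.
Qed.

Lemma mxinnerC n (X Y : 'M[C]_n) : mxinner Y X = Num.conj (mxinner X Y).
Proof. by rewrite /mxinner -mxtrace_adj adjmxM trmxCK. Qed.

(** Moving from a minimiser W0 of |l W|^2 towards W along a segment of
densities cannot decrease the norm, so the derivative at W0 is nonnegative. In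
other words, l W0 is the point nearest to 0 of the convex set of values of l,
and separates 0 from this set when it is not 0. *)
Lemma density_variational m n (l : {linear 'M[C]_m -> 'M[C]_n}) : (0 < m)%N ->
  exists2 W0, psdmx W0 /\ \tr W0 = 1 & forall W, psdmx W -> \tr W = 1 ->
    complex.Re (mxinner (l W0) (l W0)) <= complex.Re (mxinner (l W0) (l W)).
Proof.
move=> /(density_minimum l)[W0 W0d W0min]; exists W0; first exact: W0d.
move=> W Wp W1; have [W0p W01] := W0d.
have [D DE] : {D | D = l W - l W0} by exists (l W - l W0).
suff: 0 <= complex.Re (mxinner (l W0) D) *+ 2.
  rewrite pmulrn_lge0 // DE /mxinner mulmxBr raddfB /=.
  by case: (\tr _) (\tr _) => [a b] [a' b'] /=; lra.
have D_ge0 : 0 <= complex.Re (mxinner D D).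
  by have := mxtrace_gram_ge0 D; rewrite lecE => /andP[].
apply: nonneg_of_small_perturbation D_ge0 _ => t t0 t1.
pose Wt := (1 - t)%:C *: W0 + t%:C *: W.
have Wtp : psdmx Wt by apply: psdD; apply: psdZ => //; rewrite lecR; lra.
have Wt1 : \tr Wt = 1.
  by rewrite mxtraceD !mxtraceZ W01 W1 !mulr1 -rmorphD /= subrK.
have := W0min _ Wtp Wt1.
have -> : l Wt = l W0 + t%:C *: D.
  rewrite linearD !linearZ /= rmorphB rmorph1 scalerBl scale1r DE scalerBr.
  by rewrite addrA addrAC.
have -> : mxinner (l W0 + t%:C *: D) (l W0 + t%:C *: D) =
    mxinner (l W0) (l W0) +
    t%:C * (mxinner (l W0) D + Num.conj (mxinner (l W0) D) +
            t%:C * mxinner D D).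
  rewrite -mxinnerC /mxinner adjmxD adjmxZ mulmxDl !mulmxDr.
  rewrite -2!scalemxAr -2!scalemxAl 3!mxtraceD 4!mxtraceZ.
  have /CrealP -> : t%:C \is @Num.real C by apply/complex_realP; exists t.
  ring.
case: (mxinner (l W0) D) => a b; case: (mxinner D D) => a1 b1.
case: (mxinner (l W0) (l W0)) => a2 b2 /=.
rewrite !(mul0r, subr0) lerDl pmulr_rge0 // -mulr2n; exact.
Qed.

End Variational.

(** * Pairing with densities, and blocks *)

Section TracePairing.
Local Open Scope sesquilinear_scope.
Context {R : realType}.
Local Notation C := R[i].

Lemma conj_realC (a : R) : Num.conj (a%:C) = a%:C :> C.
Proof. by apply/CrealP/complex_realP; exists a. Qed.

Lemma herm_trace_mul_real m (M N : 'M[C]_m) : M^t* = M -> N^t* = N ->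
  \tr (M *m N) \is Num.real.
Proof.
by move=> Mh Nh; apply/CrealP; rewrite -mxtrace_adj adjmxM Mh Nh mxtrace_mulC.
Qed.

(** Test against the rank-one densities x x^* / |x|^2. *)
Lemma psd_of_density_pairing m (M : 'M[C]_m) : M^t* = M ->
  (forall W, psdmx W -> \tr W = 1 -> 0 <= \tr (M *m W)) -> psdmx M.
Proof.
move=> Mh M_ge0; split; first exact/hermmxP.
move=> x; have [->|x0] := eqVneq x 0; first by rewrite mulmx0 mxE.
have xx_gt0 : 0 < \tr (x^t* *m x).
  rewrite lt_def mxtrace_gram_ge0 andbT; apply: contra x0 => /eqP.
  by move/mxtrace_gram_eq0 ->.
have Wp : psdmx ((\tr (x^t* *m x))^-1 *: (x *m x^t*)).
  apply: psdZ; first by rewrite invr_ge0 ltW.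
  by have := gram_psd (x^t*); rewrite trmxCK.
have := M_ge0 _ Wp; rewrite -scalemxAr !mxtraceZ (mxtrace_mulC x).
rewrite mulVf ?gt_eqF // => /(_ erefl).
by rewrite pmulr_rge0 ?invr_gt0 // mulmxA mxtrace_mulC mulmxA mx11E.
Qed.

Lemma psd_ulsub m n (A : 'M[C]_m) (B : 'M[C]_(m, n)) (D : 'M[C]_(n, m))
    (E : 'M[C]_n) : psdmx (block_mx A B D E) -> psdmx A.
Proof.
move=> /(psd_congr (col_mx 1%:M 0)).
rewrite tr_col_mx map_row_mx -mulmxA mul_block_col mul_row_col.
by rewrite trmx0 trmx1 map_mx0 map_mx1 !mulmx0 !mulmx1 mul0mx mul1mx !addr0.
Qed.

Lemma psd_drsub m n (A : 'M[C]_m) (B : 'M[C]_(m, n)) (D : 'M[C]_(n, m))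
    (E : 'M[C]_n) : psdmx (block_mx A B D E) -> psdmx E.
Proof.
move=> /(psd_congr (col_mx 0 1%:M)).
rewrite tr_col_mx map_row_mx -mulmxA mul_block_col mul_row_col.
by rewrite trmx0 trmx1 map_mx0 map_mx1 !mulmx0 !mulmx1 mul0mx mul1mx !add0r.
Qed.

Lemma psd_block_dr m n (E : 'M[C]_n) : psdmx E ->
  psdmx (block_mx (0 : 'M[C]_m) 0 0 E).
Proof.
move=> /(psd_congr (row_mx (0 : 'M[C]_(n, m)) 1%:M)).
rewrite tr_row_mx map_col_mx -mulmxA mul_mx_row mul_col_row.
by rewrite trmx0 trmx1 map_mx0 map_mx1 !mulmx0 !mulmx1 !mul0mx !mul1mx.
Qed.

End TracePairing.

(** * The map Phi *)

Section PhiMap.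
Local Open Scope sesquilinear_scope.
Context {R : realType} {d n : nat}.
Local Notation C := R[i].
Variable A : 'I_n -> 'M[C]_d.

Lemma Phi_is_linear : linear (Phi A).
Proof.
move=> a X Y; rewrite /Phi scaler_sumr -big_split /=; apply: eq_bigr => i _.
by rewrite mulmxDr mulmxDl -scalemxAr -scalemxAl.
Qed.
HB.instance Definition _ := GRing.isLinear.Build _ _ _ _ (Phi A) Phi_is_linear.

Lemma PhiB (X Y : 'M[C]_d) : Phi A (X - Y) = Phi A X - Phi A Y.
Proof. exact: linearB. Qed.

Lemma PhiZ (a : C) (X : 'M[C]_d) : Phi A (a *: X) = a *: Phi A X.
Proof. exact: linearZ. Qed.

(** Phi is self-adjoint for the trace pairing, which is why the same Phi occurs
in the primal and in the dual constraint. *)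
Lemma trace_Phi (X Y : 'M[C]_d) : \tr (Phi A X *m Y) = \tr (X *m Phi A Y).
Proof.
rewrite /Phi mulmx_suml mulmx_sumr !raddf_sum /=; apply: eq_bigr => i _.
by rewrite -!mulmxA mxtrace_mulC !mulmxA.
Qed.

Hypothesis A_herm : forall i, A i \is hermsymmx.

Lemma Phi_adj (X : 'M[C]_d) : (Phi A X)^t* = Phi A (X^t*).
Proof.
rewrite /Phi raddf_sum map_mx_sum; apply: eq_bigr => i _.
by rewrite !adjmxM (hermmxP _ (A_herm i)) mulmxA.
Qed.

Lemma Phi_psd (X : 'M[C]_d) : psdmx X -> psdmx (Phi A X).
Proof.
move=> Xp; apply: psd_sum => i.
by have := psd_congr (A i) Xp; rewrite (hermmxP _ (A_herm i)).
Qed.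

End PhiMap.

(** * A theorem of the alternative *)

Section Alternative.
Local Open Scope sesquilinear_scope.
Context {R : realType} {d n : nat}.
Local Notation C := R[i].
Variables (A : 'I_n -> 'M[C]_d) (G : 'M[C]_(d + d)).

(** The defect of W in the linear constraints of the dual, homogenised: for the
G attached to a level c, a density W is, up to scaling, dual feasible with
objective c exactly when it vanishes.  The two components are put on
the diagonal of one matrix to share a single Frobenius inner product. *)
Definition dual_residual (W : 'M[C]_(d + d)) : 'M[C]_(d + 1) :=
  block_mx (drsubmx W - Phi A (ulsubmx W)) 0 0 (\tr (G *m W))%:M.

Lemma dual_residual_is_linear : linear dual_residual.
Proof.
move=> a X Y; rewrite /dual_residual.
rewrite scale_block_mx add_block_mx !scaler0 !addr0.
congr block_mx.
  have -> : drsubmx (a *: X + Y) = a *: drsubmx X + drsubmx Y.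
    by apply/matrixP => i j; rewrite !mxE.
  have -> : ulsubmx (a *: X + Y) = a *: ulsubmx X + ulsubmx Y.
    by apply/matrixP => i j; rewrite !mxE.
  by rewrite linearP /= scalerBr opprD addrACA.
by rewrite mulmxDr -scalemxAr mxtraceD mxtraceZ scale_scalar_mx raddfD.
Qed.
HB.instance Definition _ :=
  GRing.isLinear.Build _ _ _ _ dual_residual dual_residual_is_linear.

Hypotheses (A_herm : forall i, A i \is hermsymmx) (G_herm : G^t* = G).

(** This computes the adjoint of [dual_residual]: pairing residuals with
diag (H, r) is pairing W with L(H) + r G, where L(H) = diag (- Phi(H), H). *)
Lemma dual_residual_pairing (W0 W : 'M[C]_(d + d))
    (H := drsubmx W0 - Phi A (ulsubmx W0)) (r := \tr (G *m W0)) : W0^t* = W0 ->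
  [/\ H^t* = H, r \is Num.real & mxinner (dual_residual W0) (dual_residual W) =
      \tr ((block_mx (- Phi A H) 0 0 H + r *: G) *m W)].
Proof.
move=> W0h; have Hh : H^t* = H.
  rewrite /H adjmxD adjmxN (Phi_adj A_herm).
  by rewrite trmx_drsub map_drsubmx trmx_ulsub map_ulsubmx W0h.
have rr : r \is Num.real by exact: herm_trace_mul_real.
split=> //.
rewrite /mxinner /dual_residual adjmx_block trmx0 map_mx0 -/H -/r {}Hh.
clearbody H r.
rewrite adjmx_scalar (CrealP rr) mulmx_block !mul0mx !mulmx0 !addr0 !add0r.
rewrite mxtrace_block -scalar_mxM mxtrace_scalar mulr1n.
rewrite mulmxDl -scalemxAl mxtraceD mxtraceZ; congr (_ + _).
rewrite -[X in block_mx _ _ _ _ *m X](submxK W) mulmx_block mxtrace_block.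
rewrite !mul0mx !addr0 !add0r.
by rewrite mulmxBr mulNmx !raddfB /= raddfN /= trace_Phi addrC.
Qed.

(** Let W0 minimise the norm of the residual.  If its residual (H, r) is not
zero, the variational inequality bounds tr ((L(H) + r G) W) from below by
e = |(H, r)|^2 for every density W. *)
Lemma dual_alternative : (0 < d)%N ->
  (exists W, [/\ psdmx W, \tr W = 1, drsubmx W = Phi A (ulsubmx W) &
                 \tr (G *m W) = 0]) \/
  (exists H (r e : R), [/\ H^t* = H, 0 < e &
     psdmx (block_mx (- Phi A H) 0 0 H + r%:C *: G - (e%:C)%:M)]).
Proof.
move=> d_gt0; have dd_gt0 : (0 < d + d)%N by rewrite addn_gt0 d_gt0.
have [W0 [W0p W01] W0min] := density_variational dual_residual dd_gt0.
have [l0|l0] := eqVneq (dual_residual W0) 0; [left|right].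
  exists W0; move: l0; rewrite /dual_residual -block_mx0 => /eq_block_mx.
  case=> /eqP; rewrite subr_eq0 => /eqP W0dr _ _ /matrixP/(_ 0 0).
  by rewrite !mxE eqxx mulr1n.
have pairing W := dual_residual_pairing W (psd_herm W0p).
set H := drsubmx W0 - Phi A (ulsubmx W0) in pairing.
set r := \tr (G *m W0) in pairing.
have [Hh r_real _] := pairing 0.
pose e := complex.Re (mxinner (dual_residual W0) (dual_residual W0)).
have eE : e%:C = mxinner (dual_residual W0) (dual_residual W0).
  exact/RRe_real/ger0_real/mxtrace_gram_ge0.
exists H, (complex.Re r), e; split=> //.
  rewrite -ltcR eE lt_def mxtrace_gram_ge0 andbT; apply: contra l0 => /eqP.
  by move/mxtrace_gram_eq0 ->.
rewrite (RRe_real r_real).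
set Q := _ + _ *: G in pairing *.
have Qh : Q^t* = Q.
  rewrite /Q adjmxD adjmxZ adjmx_block adjmxN (Phi_adj A_herm) Hh G_herm.
  by rewrite (CrealP r_real) trmx0 map_mx0.
apply: psd_of_density_pairing.
  by rewrite adjmxD adjmxN adjmx_scalar conj_realC Qh.
move=> W Wp W1; rewrite mulmxBl mul_scalar_mx.
rewrite mxtraceD raddfN /= mxtraceZ W1 mulr1.
have QW_real : \tr (Q *m W) \is Num.real.
  by apply: herm_trace_mul_real => //; exact: psd_herm.
have [_ _ QWE] := pairing W.
rewrite subr_ge0 -(RRe_real QW_real) lecR -QWE; exact: W0min.
Qed.

End Alternative.

(** * Strong duality *)

Section Duality.
Local Open Scope sesquilinear_scope.
Context {R : realType} {d n : nat}.
Local Notation C := R[i].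
Variables (A0 : 'M[C]_d) (A : 'I_n -> 'M[C]_d).
Hypotheses (A0_herm : A0 \is hermsymmx) (A_herm : forall i, A i \is hermsymmx).

Lemma duality_gap (c : R) (Z S T : 'M[C]_d) : \tr S = 1 ->
  \tr (block_mx ((c%:C)%:M - A0 - Phi A Z) 1%:M 1%:M Z *m
       block_mx S (- T) (- T^t*) (Phi A S)) =
  c%:C - dual_objective A0 S T.
Proof.
move=> S1; rewrite /dual_objective /mxinner (hermmxP _ A0_herm) ReE.
rewrite mulmx_block mxtrace_block !mul1mx !mulmxBl !mxtraceD !raddfN /=.
rewrite mxtrace_adj trace_Phi mul_scalar_mx mxtraceZ S1 mulr1; by field.
Qed.

(** Dividing by r gives G + L(H / r) >= e / r.  The slack in the upper left
block lowers c by e / r; the slack in the lower right block is given back. *)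
Lemma primal_feasible_of_slack (c r e : R) (H : 'M[C]_d) :
  H^t* = H -> 0 < r -> 0 < e ->
  psdmx (block_mx (- Phi A H) 0 0 H +
         r%:C *: block_mx ((c%:C)%:M - A0) 1%:M 1%:M 0 - (e%:C)%:M) ->
  primal_feasible A0 A (c - e / r) ((r^-1)%:C *: H).
Proof.
move=> Hh r_gt0 e_gt0 Qp; split.
  by apply/hermmxP; rewrite adjmxZ conj_realC Hh.
have rV_ge0 : 0 <= (r^-1)%:C :> C by rewrite lecR invr_ge0 ltW.
have er_ge0 : 0 <= (e / r)%:C :> C by rewrite lecR divr_ge0 // ltW.
have rVr : (r^-1)%:C * r%:C = 1 :> C by rewrite -rmorphM mulVf ?gt_eqF.
have cerE : (c - e / r)%:C = c%:C - (r^-1)%:C * e%:C :> C.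
  by rewrite mulrC -rmorphM -rmorphB.
have := psdD (psdZ rV_ge0 Qp) (psd_block_dr d (psd_scalar d er_ge0)).
suff -> : (r^-1)%:C *: (block_mx (- Phi A H) 0 0 H +
         r%:C *: block_mx ((c%:C)%:M - A0) 1%:M 1%:M 0 - (e%:C)%:M) +
     block_mx 0 0 0 (e / r)%:C%:M =
     block_mx ((c - e / r)%:C%:M - A0 - Phi A ((r^-1)%:C *: H)) 1%:M 1%:M
              ((r^-1)%:C *: H) by exact.
rewrite (@scalar_mx_block _ d d) scale_block_mx opp_block_mx !add_block_mx.
rewrite scale_block_mx add_block_mx; congr block_mx.
- rewrite PhiZ; move: (Phi A H) => K; apply/matrixP => i j.
  rewrite cerE !mxE !mulrDr !mulrA !rVr !mul1r.
  by case: (i == j); rewrite ?mulr1n ?mulr0n; ring.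
- by rewrite oppr0 !addr0 add0r scalerA rVr scale1r.
- by rewrite oppr0 !addr0 add0r scalerA rVr scale1r.
- rewrite scaler0 addr0 scalerBr scale_scalar_mx -rmorphM [_^-1 * e]mulrC.
  exact: subrK.
Qed.

(** The lower block forces H >= 0, hence Phi(H) >= 0, while the upper block
forces tr (Phi(H)) <= - e d < 0. *)
Lemma no_recession (e : R) (H : 'M[C]_d) : (0 < d)%N -> 0 < e ->
  ~ psdmx (block_mx (- Phi A H - (e%:C)%:M) 0 0 (H - (e%:C)%:M)).
Proof.
move=> d_gt0 e_gt0 Hp.
have e_ge0 : 0 <= e%:C :> C by rewrite lecR ltW.
have HpE : psdmx H.
  by have := psdD (psd_drsub Hp) (psd_scalar d e_ge0); rewrite subrK.
have : 0 < \tr (Phi A H) + e%:C *+ d.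
  apply: ltr_wpDl; first exact/psd_trace_ge0/Phi_psd.
  by rewrite pmulrn_lgt0 // ltcR.
have := psd_trace_ge0 (psd_ulsub Hp).
rewrite mxtraceD !raddfN /= mxtrace_scalar -opprD oppr_ge0.
by move=> /le_lt_trans/[apply]; rewrite ltxx.
Qed.

(** A density W with zero residual can be normalised by tr (W_11): if this trace
vanished, then so would W_11, W_22 = Phi(W_11), and the trace of W.  In the
other case of the alternative, r > 0 contradicts the minimality of c, and
r <= 0 contradicts [no_recession] at H - r Z. *)
Lemma strong_duality (c : R) (Z : 'M[C]_d) : (0 < d)%N ->
  primal_optimal A0 A c Z ->
  exists S T, dual_feasible A S T /\ dual_objective A0 S T = c%:C.
Proof.
move=> d_gt0 [[Zh Xp] c_inf].
set X := block_mx _ _ _ _ in Xp.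
have c_min c' Z' : primal_feasible A0 A c' Z' -> c <= c'.
  move=> feas; rewrite -lee_fin c_inf; apply: ereal_inf_lbound.
  by exists c' => //; exists Z'.
pose G : 'M[C]_(d + d) := block_mx ((c%:C)%:M - A0) 1%:M 1%:M 0.
have Gh : G^t* = G.
  rewrite /G adjmx_block adjmxD adjmxN !adjmx_scalar conj_realC.
  by rewrite (hermmxP _ A0_herm) trmx0 map_mx0 rmorph1.
have [[W [Wp W1 Wdr GW]]|[H [r [e [Hh e_gt0 Qp]]]]] :=
  dual_alternative A_herm Gh d_gt0.
  pose s := \tr (ulsubmx W).
  have WE := submxK W.
  have Wulp : psdmx (ulsubmx W).
    by move: Wp; rewrite -WE => /psd_ulsub; rewrite block_mxKul.
  have s_gt0 : 0 < s.
    rewrite lt_def psd_trace_ge0 // andbT; apply/eqP => s0.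
    move: W1; rewrite -WE mxtrace_block Wdr -/s s0 (psd_trace_eq0 Wulp s0).
    by rewrite linear0 mxtrace0 addr0 => /esym/eqP; rewrite oner_eq0.
  have sv_real : Num.conj s^-1 = s^-1.
    by apply/CrealP; rewrite ger0_real // invr_ge0 ltW.
  pose S := s^-1 *: ulsubmx W; pose T := - (s^-1 *: ursubmx W).
  have S1 : \tr S = 1 by rewrite mxtraceZ mulVf // gt_eqF.
  have STE : block_mx S (- T) (- T^t*) (Phi A S) = s^-1 *: W.
    rewrite -[in RHS]WE scale_block_mx Wdr /T adjmxN !opprK adjmxZ sv_real.
    by rewrite linearZ trmx_ursub map_dlsubmx (psd_herm Wp).
  have STp : psdmx (block_mx S (- T) (- T^t*) (Phi A S)).
    by rewrite STE; apply: psdZ => //; rewrite invr_ge0 ltW.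
  have Sp := psd_ulsub STp.
  exists S, T; split; first by split => //; case: Sp.
  (* The pairing with L(Z) vanishes on zero residuals, so take Z = 0. *)
  have := duality_gap c 0 T S1; rewrite STE linear0 subr0 -/G.
  by rewrite -scalemxAr mxtraceZ GW mulr0 => /esym/eqP;
    rewrite subr_eq0 => /eqP.
exfalso; have [r_gt0|r_le0] := ltP 0 r.
  have /c_min := primal_feasible_of_slack Hh r_gt0 e_gt0 Qp.
  by rewrite lerBrDr gerDl leNgt divr_gt0.
have Nr_ge0 : 0 <= (- r)%:C :> C by rewrite lecR oppr_ge0.
apply: (@no_recession e (H - r%:C *: Z) d_gt0 e_gt0).
have := psdD Qp (psdZ Nr_ge0 Xp).
suff -> : block_mx (- Phi A H) 0 0 H + r%:C *: G - (e%:C)%:M + (- r)%:C *: X =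
    block_mx (- Phi A (H - r%:C *: Z) - (e%:C)%:M) 0 0
             (H - r%:C *: Z - (e%:C)%:M) by exact.
rewrite /X /G (@scalar_mx_block _ d d) rmorphN /= scaleNr !scale_block_mx.
rewrite !opp_block_mx !add_block_mx; congr block_mx.
- rewrite PhiB PhiZ; move: (Phi A H) (Phi A Z) => K L.
  by apply/matrixP => i j; rewrite !mxE; ring.
- by rewrite add0r subr0 subrr.
- by rewrite add0r subr0 subrr.
- by rewrite scaler0 addr0 addrAC.
Qed.

End Duality.

(** * Complementary slackness *)

Section Complementarity.
Local Open Scope sesquilinear_scope.
Context {R : realType}.
Local Notation C := R[i].

(** If x^* Z x = 0, then (0, x) is a null vector of the quadratic form of the
block matrix, so it lies in its kernel, and the top block reads x = 0. *)
Lemma pd_of_psd_block_1 d (M Z : 'M[C]_d) :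
  psdmx (block_mx M 1%:M 1%:M Z) -> pdmx Z.
Proof.
move=> Xp; have Zp := psd_drsub Xp; split; first by case: Zp.
move=> x x0; rewrite lt_def (proj2 Zp) andbT; apply: contra x0 => /eqP xZx.
have : block_mx M 1%:M 1%:M Z *m col_mx 0 x = 0.
  apply: psd_kernel => //.
  rewrite tr_col_mx map_row_mx -mulmxA mul_block_col mul_row_col !mulmx0 !add0r.
  by rewrite trmx0 map_mx0 mul0mx add0r mulmxA.
rewrite mul_block_col !mulmx0 !add0r mul1mx -col_mx0.
by case/eq_col_mx => ->.
Qed.

(** Strong duality makes the gap tr (X W) at most 0, and it is at least 0. *)
Lemma zero_gap_product d n (A0 : 'M[C]_d) (A : 'I_n -> 'M[C]_d) (c : R)
    (Z S T : 'M[C]_d) :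
  (0 < d)%N -> A0 \is hermsymmx -> (forall i, A i \is hermsymmx) ->
  primal_optimal A0 A c Z -> dual_optimal A0 A S T ->
  block_mx ((c%:C)%:M - A0 - Phi A Z) 1%:M 1%:M Z *m
    block_mx S (- T) (- T^t*) (Phi A S) = 0.
Proof.
move=> d_gt0 A0_herm A_herm cZ_opt [[Sh Wp S1] ST_max].
have [S' [T' [ST'_feas ST'_obj]]] := strong_duality A0_herm A_herm d_gt0 cZ_opt.
have [[Zh Xp] _] := cZ_opt.
apply: psd_trace_mul_eq0 => //; apply/eqP.
rewrite eq_le psd_trace_mul_ge0 // andbT.
rewrite duality_gap // subr_le0 -ST'_obj; exact: ST_max.
Qed.

(** P^(1/2) Z P^(1/2) is positive semidefinite with square P^(1/2) S P^(1/2).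
The right-hand side is the geometric mean of P^-1 and S. *)
Lemma eq_geometric_mean d (P S Z : 'M[C]_d) :
  pdmx P -> psdmx Z -> S = Z *m P *m Z ->
  Z = invmx (sqrtmx P) *m sqrtmx (sqrtmx P *m S *m sqrtmx P) *m
      invmx (sqrtmx P).
Proof.
move=> Ppd Zp SE; have [Qp QQ] := sqrtmxP (pd_psd Ppd).
have Qu : sqrtmx P \in unitmx.
  by have := pd_unit Ppd; rewrite -{1}QQ unitmx_mul andbb.
have -> : sqrtmx (sqrtmx P *m S *m sqrtmx P) = sqrtmx P *m Z *m sqrtmx P.
  apply: sqrtmxE.
    by have := psd_congr (sqrtmx P) Zp; rewrite (psd_herm Qp).
  rewrite SE -[in X in _ = _ *m X *m _]QQ.
  by rewrite !mulmxA.
by rewrite -!mulmxA mulKmx // mulmxV // mulmx1.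
Qed.

End Complementarity.

Theorem lemma4p4 (R : realType) (d n : nat) (d_gt0 : (0 < d)%N)
    (n_gt0 : (0 < n)%N)
    (A0 : 'M[R[i]]_d) (A : 'I_n -> 'M[R[i]]_d)
    (A0_herm : A0 \is hermsymmx) (A_herm : forall i, A i \is hermsymmx)
    (c : R) (Z S T : 'M[R[i]]_d)
    (cZ_opt : primal_optimal A0 A c Z)
    (ST_opt : dual_optimal A0 A S T) :
  [/\ pdmx Z,
      S = Z *m Phi A S *m Z,
      T = Z *m Phi A S,
      T = S *m invmx Z &
      ((c%:C)%:M - A0 - Phi A Z - invmx Z) *m S = 0] /\
  (pdmx S ->
    [/\ (c%:C)%:M - A0 - Phi A Z - invmx Z = 0,
        pdmx (Phi A S) &
        Z = invmx (sqrtmx (Phi A S)) *m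
            sqrtmx (sqrtmx (Phi A S) *m S *m sqrtmx (Phi A S)) *m
            invmx (sqrtmx (Phi A S))]).
Proof.
have [[Zh Xp] _] := cZ_opt; have [[Sh Wp _] _] := ST_opt.
have := zero_gap_product d_gt0 A0_herm A_herm cZ_opt ST_opt.
have Zpd := pd_of_psd_block_1 Xp.
have Zu := pd_unit Zpd.
have Pp := psd_drsub Wp.
have Ph := psd_herm Pp.
set M := _ - Phi A Z; set P := Phi A S in Wp Pp Ph *.
(* M S = T^*, S = Z T^* and T = Z P. *)
rewrite mulmx_block -block_mx0 => /eq_block_mx[].
rewrite !mulmxN !mul1mx => /eqP; rewrite subr_eq0 => /eqP MS _ /eqP.
rewrite subr_eq0 => /eqP SE /eqP; rewrite addrC subr_eq0 => /eqP/esym TE.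
have TtE : (map_mx Num.conj T^T) = P *m Z.
  by rewrite TE adjmxM Ph (hermmxP _ Zh).
have SZPZ : S = Z *m P *m Z by rewrite SE TtE mulmxA.
have slack : (M - invmx Z) *m S = 0.
  by rewrite mulmxBl MS SE mulKmx // subrr.
split.
  by split=> //; rewrite [in RHS]SZPZ mulmxK.
move=> Spd; have Su := pd_unit Spd.
have Ppd : pdmx P.
  apply: psd_unit_pd => //.
  by move: Su; rewrite {1}SZPZ !unitmx_mul => /andP[/andP[]].
split=> //.
  by rewrite -[LHS](mulmxK Su) slack mul0mx.
exact: eq_geometric_mean (pd_psd Zpd) SZPZ.
Qed.
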